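(* Let $T$ be a tree with distinguishing number $D(T) = D \geq 3$. Then the fixing density of $T$ satisfies $F(T)/|T| \leq \frac{D-1}{D+1}$. Moreover, this bound is sharp: for every integer $D \geq 3$ there exists a tree with distinguishing number $D$ whose fixing density equals $\frac{D-1}{D+1}$.
   Context: Graphs are finite and simple; a tree is a connected graph without cycles, and $|G|$ denotes the order (number of vertices) of a graph $G$. For a positive integer $D$, a graph $G$ is $D$-distinguishable if there is a (not necessarily proper) coloring of its vertices using at most $D$ colors such that the only automorphism of $G$ preserving the color of every vertex is the identity. The distinguishing number $D(G)$ is the minimum $D$ for which $G$ is $D$-distinguishable. A fixing set of $G$ is a set $S \subseteq V(G)$ such that the only automorphism of $G$ fixing every vertex of $S$ is the identity. The fixing number $F(G)$ is the minimum cardinality of a fixing set of $G$, and the fixing density of $G$ is $F(G)/|G|$. *)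

(* Defs.v *)
From HB Require Import structures.
From mathcomp Require Import all_boot all_order all_algebra all_fingroup.

Set Implicit Arguments.
Unset Strict Implicit.
Unset Printing Implicit Defensive.

Record sgraph := SGraph {
  vertex :> finType;
  adj : rel vertex;
  adj_sym : symmetric adj;
  adj_irrefl : irreflexive adj }.

Arguments adj {s} _ _.

(* The null graph is not connected. *)
Definition connected_graph (G : sgraph) : Prop :=
  0 < #|G| /\ forall x y : G, connect adj x y.

(* [ucycle] also accepts [:: x; y] for an edge xy, hence the bound on [size]. *)
Definition acyclic_graph (G : sgraph) : Prop :=
  forall c : seq G, 2 < size c -> ~ ucycle adj c.

Definition is_tree (G : sgraph) : Prop := connected_graph G /\ acyclic_graph G.

Definition automorphism (G : sgraph) (s : {perm G}) : bool :=
  [forall x, forall y, adj (s x) (s y) == adj x y].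

Definition distinguishing_coloring (G : sgraph) (D : nat)
    (c : {ffun G -> 'I_D}) : bool :=
  [forall s : {perm G},
    automorphism s && [forall x, c (s x) == c x] ==> (s == 1%g)].

Definition distinguishable (G : sgraph) (D : nat) : bool :=
  (0 < D) && [exists c : {ffun G -> 'I_D}, distinguishing_coloring c].

Lemma distinguishable_ex (G : sgraph) : exists D, distinguishable G D.
Proof.
exists #|G|.+1; apply/andP; split=> //.
apply/existsP; exists [ffun x => inord (enum_rank x)].
apply/forallP=> s; apply/implyP=> /andP[_ /forallP sc].
apply/eqP/permP=> x; rewrite perm1.
move: (sc x); rewrite !ffunE => /eqP /(congr1 val) /=.
rewrite !inordK ?ltnS ?(ltnW (ltn_ord _)) // => /val_inj.
exact: enum_rank_inj.
Qed.

Definition distinguishing_number (G : sgraph) : nat :=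
  ex_minn (distinguishable_ex G).

Definition fixing_set (G : sgraph) (S : {set G}) : bool :=
  [forall s : {perm G},
    automorphism s && [forall x in S, s x == x] ==> (s == 1%g)].

Lemma fixing_set_ex (G : sgraph) :
  exists n, [exists S : {set G}, fixing_set S && (#|S| == n)].
Proof.
exists #|[set: G]|; apply/existsP; exists [set: G]; rewrite eqxx andbT.
apply/forallP=> s; apply/implyP=> /andP[_ /forall_inP sx].
by apply/eqP/permP=> x; rewrite perm1; apply/eqP/sx.
Qed.

Definition fixing_number (G : sgraph) : nat := ex_minn (fixing_set_ex G).

Definition fixing_density (G : sgraph) : rat :=
  ((fixing_number G)%:R / #|G|%:R)%R.

(* Main.v *)
Require Import Defs.
From mathcomp Require Import all_boot all_order all_algebra all_fingroup.
From mathcomp Require Import zify.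

Set Implicit Arguments.
Unset Strict Implicit.
Unset Printing Implicit Defensive.

(** The bound can be read off the leaves of the tree [T].

    An automorphism of a tree that fixes every leaf is the identity
    ([leaves_fixing]).  Hence so is one that fixes a smaller set: at a vertex
    [v] carrying at least two leaves, one leaf may be dropped, since the others
    force [v], and then the dropped leaf, to be fixed
    ([pruned_leaves_fixing]).  A vertex with [m] leaves thus contributes 1
    element if [m = 1] and [m - 1] elements if [m >= 2].

    Charge this contribution to the [m + 1] vertices formed by [v] and its
    leaves; these groups are disjoint as soon as [T] has three vertices.
    Exchanging two leaves with the same neighbor is an automorphism, so they
    have different colors in any distinguishing coloring and [m <= D].  The
    ratio is then 1/2, at most (D - 1)/(D + 1) because [D >= 3], or
    (m - 1)/(m + 1), at most (D - 1)/(D + 1) because [m <= D]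
    ([tree_fixing_number_le]).

    Equality holds for the star with [D] leaves: the same exchanges show that
    it needs [D] colors and that a fixing set omits at most one leaf. *)

(** * Paths in acyclic graphs *)

(** A walk between two distinct neighbors of [x] that avoids [x] would shorten
    to a simple path and close up into a cycle through [x]. *)
Lemma acyclic_branches_disjoint (G : sgraph) (x a : G) (p : seq G) :
  acyclic_graph G -> adj x a -> adj x (last a p) -> path adj a p ->
  x \notin a :: p -> a = last a p.
Proof.
move=> acG xa xb pp; case/shortenP: pp xb => q pq uq sub_qp xb xNp.
case: q => [//|b q] in pq uq sub_qp xb *.
case: (acG (x :: a :: b :: q)) => //; apply/andP; split.
  rewrite /= xa; move: pq => /= /andP[-> pq] /=.
  by rewrite rcons_path pq adj_sym.
rewrite cons_uniq uq andbT; apply: contra xNp.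
by rewrite !(in_cons a) => /orP[->|/sub_qp ->]; rewrite ?orbT.
Qed.

Lemma acyclic_path_uniq (G : sgraph) (x : G) (p q : seq G) :
  acyclic_graph G -> path adj x p -> path adj x q ->
  uniq (x :: p) -> uniq (x :: q) -> last x p = last x q -> p = q.
Proof.
move=> acG; elim: p x q => [|a p IHp] x [|b q] //.
- by move=> _ _ _ /andP[xNq _] /= xE; rewrite [x]xE mem_last in xNq.
- by move=> _ _ /andP[xNp _] _ /= xE; rewrite -[x]xE mem_last in xNp.
move=> /= /andP[xa pp] /andP[xb pq] /andP[xNp up] /andP[xNq uq] eq_last.
suff eq_ab : a = b by rewrite -eq_ab in pq uq eq_last *; rewrite (IHp a q).
(* Following [p] forwards and then [q] backwards leads from [a] to [b]. *)
pose r := rev (belast b q).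
have last_r : last (last b q) r = b.
  by rewrite /r; case: (q) => //= c s; rewrite rev_cons last_rcons.
have last_pr : last a (p ++ r) = b by rewrite last_cat eq_last.
rewrite -last_pr; apply: (acyclic_branches_disjoint (x := x)) => //.
- by rewrite last_pr.
- rewrite cat_path pp eq_last rev_path /=.
  by rewrite (eq_path (e' := adj)) // => y z; rewrite adj_sym.
rewrite -cat_cons mem_cat negb_or xNp mem_rev /=.
by apply: contra xNq; apply: mem_belast.
Qed.

(** * Leaves of a tree *)

Definition nbrs (G : sgraph) (x : G) : {set G} := [set y | adj x y].

Definition leaf (G : sgraph) (x : G) : bool := #|nbrs x| == 1.

Definition leaves_at (G : sgraph) (v : G) : {set G} :=
  [set l in nbrs v | leaf l].

Lemma leaf_nbr (G : sgraph) (l v w : G) :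
  leaf l -> adj l v -> adj l w = (w == v).
Proof.
move=> /cards1P[u Nl] lv; have mN z : adj l z = (z == u).
  by rewrite -in_set1 -Nl inE.
by move: lv; rewrite !mN => /eqP ->.
Qed.

Lemma leaves_atP (G : sgraph) (v l : G) :
  reflect (leaf l /\ forall w, adj l w = (w == v)) (l \in leaves_at v).
Proof.
rewrite !inE; apply: (iffP andP) => [[vl lf]|[lf N]].
  by split=> // w; apply: leaf_nbr; rewrite // adj_sym.
by rewrite lf adj_sym N.
Qed.

(** A longest extension must stop at a leaf: at any other vertex there is a
    second neighbor, which acyclicity keeps off the path.  A one-vertex path is
    excluded because its end has no predecessor to turn away from. *)
Lemma path_extends_to_leaf (G : sgraph) (x : G) (p : seq G) :
  acyclic_graph G -> path adj x p -> uniq (x :: p) -> p != [::] ->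
  exists q, [/\ path adj x (p ++ q), uniq (x :: p ++ q)
              & leaf (last x (p ++ q))].
Proof.
move=> acG; have [n le_n] := ubnP (#|G| - size p).
elim: n => // n IHn in p le_n *.
case/lastP: p le_n => // p l le_n pp up _.
have [lf|nlf] := boolP (leaf l).
  by exists [::]; rewrite cats0 last_rcons.
move: (pp); rewrite rcons_path => /andP[pp' zl].
have [w lw wz] : exists2 w, adj l w & w != last x p.
  have zN : last x p \in nbrs l by rewrite inE adj_sym.
  move: nlf; rewrite /leaf (cardsD1 (last x p)) zN add1n eqSS cards_eq0.
  case/set0Pn=> w; rewrite !inE => /andP[wz lw].
  by exists w.
have lNp : l \notin x :: p.
  by move: up; rewrite -rcons_cons rcons_uniq => /andP[].
have wNl : w != l by apply: contraTneq lw => ->; rewrite adj_irrefl.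
have wNp : w \notin x :: rcons p l.
  rewrite -rcons_cons mem_rcons in_cons negb_or wNl /=.
  apply: contraNN wz => wp; case/splitPl: wp zl lNp pp' lw => p1 p2 <-.
  rewrite last_cat -cat_cons mem_cat negb_or cat_path.
  move=> zl /andP[lNp1 lNp2] /andP[_ pp2] lw; apply/eqP.
  apply: (acyclic_branches_disjoint (x := l)) => //; first by rewrite adj_sym.
  rewrite inE negb_or lNp2 andbT.
  by apply: contraNneq lNp1 => ->; apply: mem_last.
have upw : uniq (x :: rcons (rcons p l) w).
  by rewrite -rcons_cons rcons_uniq wNp.
case: (IHn (rcons (rcons p l) w)) => //.
- have lt_p : size (rcons p l) < #|G|.
    have := max_card (mem (x :: rcons (rcons p l) w)).
    by rewrite (card_uniqP upw) /= size_rcons => /ltnW.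
  by rewrite size_rcons; lia.
- by rewrite rcons_path pp last_rcons.
- by rewrite -size_eq0 size_rcons.
by move=> q [pq uq lq]; exists (w :: q); rewrite -cat_rcons.
Qed.

Lemma automorphismP (G : sgraph) (s : {perm G}) :
  reflect (forall x y, adj (s x) (s y) = adj x y) (automorphism s).
Proof. by apply: (iffP 'forall_'forall_eqP). Qed.

Lemma fixing_setP (G : sgraph) (S : {set G}) :
  reflect (forall s : {perm G}, automorphism s -> {in S, forall x, s x = x} ->
             s = 1%g)
          (fixing_set S).
Proof.
apply: (iffP forallP) => fixS s.
  move=> auts sS; apply/eqP; apply: (implyP (fixS s)); rewrite auts.
  by apply/forall_inP=> x xS; apply/eqP/sS.
by apply/implyP=> /andP[auts /forall_inP sS]; apply/eqP/fixS => // x /sS/eqP.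
Qed.

Lemma leaf_automorphism (G : sgraph) (s : {perm G}) (l : G) :
  automorphism s -> leaf (s l) = leaf l.
Proof.
move=> /automorphismP auts; rewrite /leaf -(card_imset (mem (nbrs l)) (@perm_inj _ s)).
congr (#|pred_of_set _| == 1); apply/setP=> y.
by rewrite -(permKV s y) (mem_imset _ _ (@perm_inj _ s)) !inE auts.
Qed.

(** If [s] moves [x], extend the path from [s x] to [x] up to a leaf [l].  Its
    final part from [x] to [l] is mapped to another path from [s x] to
    [s l = l], which is strictly shorter, against uniqueness of paths. *)
Lemma leaves_fixing (G : sgraph) :
  is_tree G -> fixing_set [set l : G | leaf l].
Proof.
move=> [[_ conG] acG]; apply/fixing_setP=> s auts sl.
apply/permP=> x; rewrite perm1; apply/eqP/negPn/negP=> sxNx.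
have /connectP[p0 pp0 last0] := conG (s x) x.
case/shortenP: pp0 last0 => p pp up _ lastp {p0}.
have pN0 : p != [::] by apply: contraNneq sxNx => p0; rewrite {2}lastp p0.
have [q [ppq upq]] := path_extends_to_leaf acG pp up pN0.
move: (ppq); rewrite last_cat cat_path -lastp => /andP[_ pq] lq.
have uq : uniq (x :: q).
  move: upq; rewrite -cat_cons cat_uniq => /and3P[_ /hasPn disj uq].
  rewrite /= uq andbT; apply/negP=> /disj/negP; apply.
  by rewrite {1}lastp; apply: mem_last.
have/(congr1 size) : p ++ q = map s q.
  apply: (acyclic_path_uniq acG ppq) => //.
  - by rewrite path_map (eq_path (e' := adj)) //; apply/automorphismP.
  - by rewrite -map_cons map_inj_uniq //; apply: perm_inj.
  by rewrite last_cat -lastp last_map sl // inE.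
rewrite size_cat size_map => /eqP; rewrite -{2}(add0n (size q)) eqn_add2r.
by rewrite size_eq0 (negPf pN0).
Qed.

(** * Leaves at a common vertex *)

Lemma tperm_leaves_automorphism (G : sgraph) (v l l' : G) :
  l \in leaves_at v -> l' \in leaves_at v -> automorphism (tperm l l').
Proof.
have not_center k : k \in leaves_at v -> (k == v) = false.
  case/leaves_atP=> _ Nk; apply/eqP=> kv.
  by have := Nk v; rewrite eqxx -{1}kv adj_irrefl.
move=> lv l'v; have [lNv l'Nv] := (not_center _ lv, not_center _ l'v).
case/leaves_atP: lv => _ Nl; case/leaves_atP: l'v => _ Nl'.
have N1 w : adj w l = (w == v) by rewrite adj_sym.
have N2 w : adj w l' = (w == v) by rewrite adj_sym.
by apply/automorphismP=> x y; case: tpermP => [->|->|_ _];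
   case: tpermP => [->|->|_ _]; rewrite ?(Nl, Nl', N1, N2) ?lNv ?l'Nv.
Qed.

Lemma leaves_at_le_distinguishable (G : sgraph) (v : G) (D : nat) :
  distinguishable G D -> #|leaves_at v| <= D.
Proof.
case/andP=> _ /existsP[c /forallP cD].
rewrite -[D]card_ord -(card_in_imset (f := c)) ?max_card // => l l' lv l'v eq_c.
have /implyP := cD (tperm l l'); rewrite (tperm_leaves_automorphism lv l'v).
have -> /= : [forall x, c (tperm l l' x) == c x].
  by apply/forallP=> x; case: tpermP => // ->; rewrite eq_c.
by move=> /(_ isT)/eqP t1; rewrite -(tpermL l l') t1 perm1.
Qed.

Lemma leaves_at_le_fixing_set (G : sgraph) (v : G) (S : {set G}) :
  fixing_set S -> #|leaves_at v| <= #|S|.+1.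
Proof.
move=> /fixing_setP fixS; rewrite -(cardsID S (leaves_at v)) -addn1.
rewrite leq_add ?subset_leq_card ?subsetIr //.
apply/card_le1_eqP=> l l'; rewrite !in_setD => /andP[lS lv] /andP[l'S l'v].
have/fixS/(_ _)t1 := tperm_leaves_automorphism lv l'v.
rewrite -(tpermL l l') t1 ?perm1 // => x xS.
by apply: tpermD; [apply: contraNneq lS|apply: contraNneq l'S] => ->.
Qed.

(** * The upper bound *)

(** A lone leaf has to be kept: without a second leaf next to it nothing would
    force its neighbor to be fixed.  The default value [v] of [odflt] is never
    reached, since the set of leaves is nonempty in that branch. *)
Definition pruned_leaves (G : sgraph) (v : G) : {set G} :=
  if #|leaves_at v| <= 1 then leaves_at v
  else leaves_at v :\ odflt v [pick l in leaves_at v].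

Lemma card_pruned_leaves (G : sgraph) (v : G) :
  #|pruned_leaves v| =
  if #|leaves_at v| <= 1 then #|leaves_at v| else #|leaves_at v|.-1.
Proof.
rewrite /pruned_leaves; case: leqP => // gt1.
case: pickP => [l lv|no] /=; first by rewrite (cardsD1 l (leaves_at v)) lv.
by move: gt1; rewrite eq_card0.
Qed.

Lemma pruned_leaves_fixing (G : sgraph) :
  is_tree G -> fixing_set (\bigcup_(v : G) pruned_leaves v).
Proof.
move=> treeG; apply/fixing_setP=> s auts sS.
have sR v l : l \in pruned_leaves v -> s l = l.
  by move=> lR; apply: sS; apply/bigcupP; exists v.
apply: (fixing_setP _ (leaves_fixing treeG)) => // l; rewrite inE => lf.
have [v lv] : exists v, l \in leaves_at v.
  case/cards1P: (lf) => v Nl; exists v; apply/leaves_atP; split=> // w.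
  by rewrite -in_set1 -Nl inE.
have [lR|lNR] := boolP (l \in pruned_leaves v); first exact: sR lR.
have gt1 : 1 < #|leaves_at v|.
  by rewrite ltnNge; apply: contra lNR; rewrite /pruned_leaves => ->.
have removed l' : l' \in leaves_at v -> l' != l -> l' \in pruned_leaves v.
  move: lNR; rewrite /pruned_leaves leqNgt gt1 /= !in_setD1 lv andbT negbK.
  by move=> /eqP <- -> ->.
(* A second leaf at [v] is in the set, hence fixed; so its neighbor [v] is. *)
have/set0Pn[l' l'R] : pruned_leaves v != set0.
  by rewrite -card_gt0 card_pruned_leaves (leqNgt _ 1) gt1 /=; lia.
have l'v : l' \in leaves_at v.
  by move: l'R; rewrite /pruned_leaves leqNgt gt1 /= in_setD1 => /andP[].
have sv : s v = v.
  case/leaves_atP: l'v => _ Nl'.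
  by apply/eqP; rewrite -Nl' -{1}(sR _ _ l'R) (automorphismP _ auts) Nl'.
have slv : s l \in leaves_at v.
  rewrite inE leaf_automorphism // lf andbT inE -{1}sv (automorphismP _ auts).
  by case/setIdP: lv; rewrite inE.
apply/eqP/negPn/negP=> slNl; have/sR/perm_inj := removed _ slv slNl.
by move/eqP; rewrite (negPf slNl).
Qed.

(** Two adjacent leaves form a whole component.  This is what makes the groups
    in the counting argument disjoint. *)
Lemma support_nonleaf (G : sgraph) (v l : G) :
  connected_graph G -> 2 < #|G| -> l \in leaves_at v -> ~~ leaf v.
Proof.
move=> [_ conG] gt2 /leaves_atP[_ Nl]; apply/negP=> lfv.
have Nv w : adj v w = (w == l) by apply: leaf_nbr => //; rewrite adj_sym Nl.
have vl_closed : closed adj [set v; l].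
  apply: intro_closed => [|x y xy]; first exact/sym_connect_sym/adj_sym.
  by rewrite !inE => /orP[] /eqP xE; move: xy; rewrite xE ?Nv ?Nl => /eqP->;
     rewrite eqxx ?orbT.
suff : #|G| <= #|[set v; l]|.
  by rewrite cards2 leqNgt (leq_ltn_trans _ gt2) //; case: (v != l).
apply/subset_leq_card/subsetP=> x _.
by rewrite -(closed_connect vl_closed (conG v x)) set21.
Qed.

(** Double counting: each leaf has exactly one neighbor. *)
Lemma sum_leaves_at (G : sgraph) :
  \sum_(v : G) #|leaves_at v| = \sum_(v : G) leaf v.
Proof.
transitivity (\sum_(v : G) \sum_(l : G) (leaf l && adj l v)).
  apply: eq_bigr => v _; rewrite -sum1_card big_mkcond /=.
  by apply: eq_bigr => l _; rewrite !inE andbC adj_sym; case: ifP.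
rewrite exchange_big; apply: eq_bigr => l _ /=.
have [lf|_] := boolP (leaf l); last by rewrite big1.
rewrite -[RHS](eqP lf) -sum1_card [RHS]big_mkcond /=.
by apply: eq_bigr => v _; rewrite inE; case: ifP.
Qed.

Lemma fixing_number_le (G : sgraph) (S : {set G}) :
  fixing_set S -> fixing_number G <= #|S|.
Proof.
move=> fixS; rewrite /fixing_number; case: ex_minnP => n _; apply.
by apply/existsP; exists S; rewrite fixS eqxx.
Qed.

Lemma setC1_fixing (G : sgraph) (x : G) : fixing_set [set~ x].
Proof.
apply/fixing_setP=> s _ sS; apply/permP=> y; rewrite perm1.
have [->|yx] := eqVneq y x; last by apply: sS; rewrite !inE.
apply/eqP/negPn/negP=> sxNx.
have/sS/perm_inj/eqP : s x \in [set~ x] by rewrite !inE.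
by rewrite (negPf sxNx).
Qed.

Lemma tree_fixing_number_le (T : sgraph) (D : nat) :
  is_tree T -> distinguishable T D -> 2 < D ->
  D.+1 * fixing_number T <= D.-1 * #|T|.
Proof.
move=> treeT distT D_gt2; case: (treeT) => -[T_gt0 _] _.
(* A single edge has adjacent leaves, so small trees are treated apart. *)
have [T_le2|T_gt2] := leqP #|T| 2.
  case/card_gt0P: T_gt0 => x _; have := fixing_number_le (setC1_fixing x).
  by rewrite cardsC1; nia.
have := fixing_number_le (pruned_leaves_fixing treeT).
set S := \bigcup_v _ => F_le.
have S_le : #|S| <= \sum_(v : T) #|pruned_leaves v|.
  rewrite /S; elim/big_rec2: _ => [|v n A _ A_le]; first by rewrite cards0.
  by rewrite (leq_trans (leq_card_setU _ _)) ?leq_add2l.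
(* Each leaf is charged once, as a leaf, and each support once, as a nonleaf. *)
have T_ge : \sum_(v : T) (#|leaves_at v| + (0 < #|leaves_at v|)) <= #|T|.
  rewrite big_split /= sum_leaves_at -big_split -sum1_card leq_sum //= => v _.
  case: posnP => [_|]; first by case: leaf.
  by case/card_gt0P=> l /(support_nonleaf treeT.1 T_gt2)/negPf ->.
apply: leq_trans (leq_mul (leqnn _) T_ge).
apply: leq_trans (leq_mul (leqnn _) (leq_trans F_le S_le)) _.
rewrite !big_distrr leq_sum //= => v _; rewrite card_pruned_leaves.
have := leaves_at_le_distinguishable v distT.
by case: #|leaves_at v| => [|[|m]] /=; nia.
Qed.

(** * Sharpness: stars *)

Section Star.

Variable D : nat.

Definition star_rel : rel (option 'I_D) := fun x y => isSome x (+) isSome y.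

Lemma star_rel_sym : symmetric star_rel.
Proof. by move=> x y; rewrite /star_rel addbC. Qed.

Lemma star_rel_irrefl : irreflexive star_rel.
Proof. by move=> x; rewrite /star_rel addbb. Qed.

Definition star : sgraph := SGraph star_rel_sym star_rel_irrefl.

Lemma star_tree : is_tree star.
Proof.
split; first split; first by apply/card_gt0P; exists None.
  have from_center (x : star) : connect adj (None : star) x.
    by case: x => [i|]; [apply: connect1|apply: connect0].
  move=> x y; apply: connect_trans (from_center y).
  by rewrite (sym_connect_sym (@adj_sym star)).
move=> [|x [|y [|z c]]] //= _; rewrite /ucycle /=.
case: x y z => [i|] [j|] [k|] //=; last by rewrite andbF.
case: c => [|[l|] c] //=.
by rewrite !inE !(andbF, orbT).
Qed.

Lemma card_star : #|star| = D.+1.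
Proof. by rewrite card_option card_ord. Qed.

Lemma card_star_leaves : #|leaves_at (None : star)| = D.
Proof.
have -> : leaves_at (None : star) = [set Some i | i in 'I_D].
  apply/setP=> x; apply/leaves_atP/imsetP.
    by case: x => [i _|[_ /(_ None)]]; [exists i|rewrite adj_irrefl].
  case=> i _ ->; split; last by case.
  apply/cards1P; exists None; apply/setP=> -[j|]; by rewrite !inE.
by rewrite card_imset ?card_ord //; apply: Some_inj.
Qed.

(** The center may share the color of a leaf [i0]: another leaf [i1] is fixed
    because its color is unique, which fixes the center and thereby [i0]. *)
Lemma star_distinguishable : 1 < D -> distinguishable star D.
Proof.
move=> D_gt1; have D_gt0 : 0 < D by lia.
rewrite /distinguishable D_gt0.
pose i0 := Ordinal D_gt0; pose i1 := Ordinal D_gt1.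
apply/existsP; exists [ffun x : star => odflt i0 x].
apply/forallP=> s; apply/implyP=> /andP[/automorphismP auts /forallP sc].
have sE i : i != i0 -> s (Some i) = Some i.
  move=> iN0; move: (sc (Some i)); rewrite !ffunE /=.
  by case: (s (Some i)) => [j /eqP /= ->|/= /eqP i0E] //; rewrite -i0E eqxx in iN0.
have sN : s None = None.
  move: (auts None (Some i1)); rewrite (sE i1) //.
  by rewrite /adj /= /star_rel /=; case: (s None).
apply/eqP/permP=> -[i|]; rewrite perm1 //.
move: (sc (Some i)); rewrite !ffunE /=.
case E: (s (Some i)) => [j|] /eqP /=; first by move->.
by move: E; rewrite -{1}sN => /perm_inj.
Qed.

Lemma star_distinguishing_number : 1 < D -> distinguishing_number star = D.
Proof.
move=> D_gt1; rewrite /distinguishing_number; case: ex_minnP => n distn min_n.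
apply/eqP; rewrite eqn_leq min_n ?star_distinguishable //=.
by rewrite -{1}card_star_leaves leaves_at_le_distinguishable.
Qed.

Lemma star_fixing_number_ge : D.-1 <= fixing_number star.
Proof.
rewrite /fixing_number; case: ex_minnP => n /existsP[S /andP[fixS /eqP <-]] _.
by have := leaves_at_le_fixing_set (None : star) fixS; rewrite card_star_leaves; lia.
Qed.

End Star.

Local Open Scope ring_scope.
Import Order.TTheory GRing.Theory Num.Theory.

Theorem theorem7 :
  (forall (T : sgraph) (D : nat), is_tree T -> distinguishing_number T = D ->
     (3 <= D)%N -> fixing_density T <= (D%:R - 1) / (D%:R + 1) :> rat)
  /\
  (forall D : nat, (3 <= D)%N ->
     exists T : sgraph, [/\ is_tree T, distinguishing_number T = D
       & fixing_density T = (D%:R - 1) / (D%:R + 1) :> rat]).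
Proof.
have bound (T : sgraph) D : is_tree T -> distinguishing_number T = D ->
    (3 <= D)%N -> fixing_density T <= (D%:R - 1) / (D%:R + 1) :> rat.
  move=> treeT; rewrite /distinguishing_number; case: ex_minnP => n distT _ <- D3.
  have := tree_fixing_number_le treeT distT D3.
  case: (n) D3 => // m _ /=; rewrite /fixing_density => le_F.
  rewrite -{1}natr1 addrK natr1 ler_pdivrMr ?ltr0n; last by case: treeT.1.
  rewrite mulrAC ler_pdivlMr ?ltr0Sn // -!natrM ler_nat mulnC.
  exact: le_F.
split=> // D D3; have D1 : (1 < D)%N by lia.
exists (star D); have distD := star_distinguishing_number D1.
split=> //; first exact: star_tree.
apply/eqP; rewrite eq_le bound //; last exact: star_tree.
rewrite /fixing_density card_star -[D.+1%:R]natr1 ler_pM2r ?invr_gt0 ?ltr_wpDl //.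
have := star_fixing_number_ge D; case: (D) D3 => // m _ /= le_m.
by rewrite -natr1 addrK ler_nat.
Qed.
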